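(* Suppose $M$ is an $(\varepsilon,\delta)$ user-level differentially private algorithm, where $\delta=o\left(\frac{\varepsilon\alpha}{d^2\sqrt m\log^2\left(\frac{d}{\varepsilon\alpha}\right)}\right)$, taking as input $X=\{X_{i,j}\}$ with $1\le i\le n$, $1\le j\le m$, $X_{i,j}\in[d]$, and outputting a vector in $\mathbb{R}^d$. Suppose moreover that for every distribution $\tilde p$ over $[d]$, if $X_{i,j}\overset{i.i.d.}{\sim}\tilde p$ then $\mathbb{E}\left[\|M(X)-\tilde p\|_1^2\right]\le\frac{\alpha^2}{1000}$. Then $n\sqrt m=\Omega\left(\varepsilon^{-1}\alpha^{-1}d/\log^6\left(\frac{d}{\alpha\varepsilon}\right)\right)$.
   Context: A distribution $\tilde p$ over $[d]$ is identified with its probability vector in $\mathbb{R}^d$. User-level differential privacy: datasets $X,X'$ are neighboring if there is a single user $i$ such that $X_{i',j}=X'_{i',j}$ for all $i'\ne i$ and all $j$; a randomized algorithm $M$ is $(\varepsilon,\delta)$ user-level differentially private if for all neighboring $X,X'$ and all measurable $S$, $\mathbb{P}[M(X)\in S]\le e^\varepsilon\mathbb{P}[M(X')\in S]+\delta$.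
   Formalization: The formal theorem assumes d ≥ 2, 0 < α ≤ 1 and d/(εα) ≥ 2; without such bounds the claim fails: for d = 1 or α ≥ √4000 a constant M is accurate enough, and the bound blows up as d/(εα) → 1. *)

(* Defs.v *)
From HB Require Import structures.
From mathcomp Require Import all_boot all_order all_algebra.
From mathcomp Require Import all_classical all_reals all_analysis.

Set Implicit Arguments.
Unset Strict Implicit.
Unset Printing Implicit Defensive.

Import Order.TTheory GRing.Theory Num.Theory.
Import numFieldNormedType.Exports.

Local Open Scope classical_set_scope.
Local Open Scope ring_scope.

(* [R^d] as a measurable space: tuples carry the product sigma-algebra, which
   for Borel factors is the Borel sigma-algebra of [R^d]. *)
Definition vec (R : realType) (d : nat) := d.-tuple (measurableTypeR R).

Definition l1dist (R : realType) (d : nat) (x y : vec R d) : R :=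
  \sum_(k < d) `|tnth x k - tnth y k|.

Definition is_distribution (R : realType) (d : nat) (p : vec R d) : Prop :=
  (forall k : 'I_d, 0 <= tnth p k) /\ \sum_(k < d) tnth p k = 1.

(* Row [i] holds the [m] samples of user [i]; the universe [d] is ['I_d]. *)
Definition dataset (n m d : nat) := 'M['I_d]_(n, m).

Definition neighboring (n m d : nat) (X X' : dataset n m d) : Prop :=
  exists i : 'I_n, forall i' : 'I_n, i' != i ->
    forall j : 'I_m, X i' j = X' i' j.

(* A randomized algorithm, given by the law of its output on each dataset.
   There are finitely many datasets, so no measurability in the input is
   required. *)
Definition algorithm (R : realType) (n m d : nat) :=
  dataset n m d -> probability (vec R d) R.

Definition user_level_dp (R : realType) (n m d : nat)
    (M : algorithm R n m d) (eps delta : R) : Prop :=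
  forall X X' : dataset n m d, neighboring X X' ->
  forall S : set (vec R d), measurable S ->
    (M X S <= (expR eps)%:E * M X' S + delta%:E)%E.

(* The law of a dataset whose [n * m] entries are i.i.d. with law [p]. *)
Definition iid_prob (R : realType) (n m d : nat) (p : vec R d)
    (X : dataset n m d) : R :=
  \prod_(i < n) \prod_(j < m) tnth p (X i j).

(* The expectation of [||M(X) - p||_1 ^ 2], over both the i.i.d. dataset [X]
   and the internal randomness of [M]. *)
Definition expected_sq_error (R : realType) (n m d : nat)
    (M : algorithm R n m d) (p : vec R d) : \bar R :=
  (\sum_(X : dataset n m d)
     (iid_prob p X)%:E * \int[M X]_y (l1dist y p ^+ 2)%:E)%E.

(* Main.v *)
(* Fingerprinting. Put [a = alpha / 2], [h = d / 2], and for [x] in the cube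
   [[-a, a]^h] tilt the uniform distribution on [d] points by [1 + x_j] and
   [1 - x_j] on the [j]-th pair of coordinates. An accurate mechanism must guess
   the signs of most of the [x_j]: its guesses [v] have a mean that correlates
   with [x], and the divergence theorem on the cube yields an [x] at which the
   weighted divergence of this mean is of order [a h]. By differentiating the
   likelihood, that divergence equals the sum over the users of the expected
   score [sum_l xi_v (X_il)], where [xi_v] is bounded by [2 a^2] and centred.
   Privacy bounds each of these by the same expectation with an independent
   fresh row for user [i], for which the score has exponential moments at scale
   [a^2 sqrt m]; hence each user contributes [O(eps a^2 sqrt m)] up to a small
   multiple of [delta], so [n sqrt m] is at least of order [d / (eps alpha)].
   The logarithms in the statement are bounded below by [ln 2] and only lose
   constants. *)

Require Import Defs.
From HB Require Import structures.
From mathcomp Require Import all_boot all_order all_algebra.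
From mathcomp Require Import all_classical all_reals all_analysis.
From mathcomp Require Import measurable_realfun zify ring lra.

Set Implicit Arguments.
Unset Strict Implicit.
Unset Printing Implicit Defensive.

Import Order.TTheory GRing.Theory Num.Theory.
Import numFieldNormedType.Exports.

Local Open Scope classical_set_scope.
Local Open Scope ring_scope.

(** * Partial derivatives on a cube and a discrete divergence theorem *)

Section CubeDivergence.
Variables (R : realType) (h : nat) (a : R).
Implicit Types (x : 'I_h -> R) (j : 'I_h) (F G : ('I_h -> R) -> R).

Definition upd x j (t : R) : 'I_h -> R := fun i => if i == j then t else x i.

Definition in_cube x := forall i, `|x i| <= a.

(* The quadratic remainder is uniform on the cube, so that it survives the
   summation over a fine grid in [divergence_nonneg]. *)
Definition has_partial j F F' := exists2 K : R, 0 <= K &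
  forall x, in_cube x -> [/\ `|F x| <= K, `|F' x| <= K &
    forall t, `|t| <= a ->
      `|F (upd x j t) - F x - (t - x j) * F' x| <= K * (t - x j) ^+ 2].

Lemma in_cube_upd x j t : in_cube x -> `|t| <= a -> in_cube (upd x j t).
Proof. by move=> hx ht i; rewrite /upd; case: ifP. Qed.

Lemma has_partial_ext j F F' G G' :
  (forall x, in_cube x -> F x = G x) -> (forall x, in_cube x -> F' x = G' x) ->
  has_partial j F F' -> has_partial j G G'.
Proof.
move=> FG FG' [K K0 HK]; exists K => // x hx; have [h1 h2 h3] := HK x hx.
rewrite -FG // -FG' //; split=> // t ht.
by rewrite -FG ?h3 //; exact: in_cube_upd.
Qed.

Lemma has_partial_indep j F (K : R) : (forall x, in_cube x -> `|F x| <= K) ->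
  (forall x t, F (upd x j t) = F x) -> has_partial j F (fun=> 0).
Proof.
move=> hF hu; exists `|K| => // x hx; split=> [||t _].
- exact: le_trans (hF _ hx) (ler_norm _).
- by rewrite normr0.
- by rewrite hu subrr mulr0 subr0 normr0 mulr_ge0 // sqr_ge0.
Qed.

Lemma has_partial_coord j : 0 <= a -> has_partial j (fun x => x j) (fun=> 1).
Proof.
move=> a0; exists (a + 1) => [|x hx]; first by lra.
split=> [||t _].
- by apply: le_trans (hx j) _; lra.
- by rewrite normr1; lra.
- rewrite /upd eqxx mulr1 subrr normr0 mulr_ge0 ?sqr_ge0 //; lra.
Qed.

Lemma has_partialD j F F' G G' : has_partial j F F' -> has_partial j G G' ->
  has_partial j (fun x => F x + G x) (fun x => F' x + G' x).
Proof.
move=> [K K0 HK] [L L0 HL]; exists (K + L) => [|x hx]; first exact: addr_ge0.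
have [h1 h2 h3] := HK x hx; have [l1 l2 l3] := HL x hx; split=> [||t ht].
- exact: le_trans (ler_normD _ _) (lerD h1 l1).
- exact: le_trans (ler_normD _ _) (lerD h2 l2).
- have -> : F (upd x j t) + G (upd x j t) - (F x + G x)
    - (t - x j) * (F' x + G' x) = (F (upd x j t) - F x - (t - x j) * F' x) +
      (G (upd x j t) - G x - (t - x j) * G' x) by ring.
  by apply: le_trans (ler_normD _ _) _; rewrite [leRHS]mulrDl; exact: lerD (h3 t ht) (l3 t ht).
Qed.

Hypothesis a0 : 0 <= a.

Lemma has_partialM j F F' G G' : has_partial j F F' -> has_partial j G G' ->
  has_partial j (fun x => F x * G x) (fun x => F' x * G x + F x * G' x).
Proof.
have a_ge0 := a0; move=> [K K0 HK] [L L0 HL].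
have KL0 : 0 <= K * L by exact: mulr_ge0.
have aK0 : 0 <= a * K by exact: mulr_ge0.
(* Since [|t - x j| <= 2 * a], the three terms of the remainder below have coefficients
   [(1 + 2 * a) * (K * L)], [K * L] and [K * L]. *)
exists (4 * (1 + a) * (K * L)) => [|x hx].
  by apply: mulr_ge0 => //; lra.
have [h1 h2 h3] := HK x hx; have [l1 l2 l3] := HL x hx.
have KL4 : K * L + K * L <= 4 * (1 + a) * (K * L).
  by have := mulr_ge0 a0 KL0; lra.
split=> [||t ht].
- by rewrite normrM; apply: le_trans (ler_pM _ _ h1 l1) _ => //; lra.
- apply: le_trans (ler_normD _ _) (le_trans _ KL4); rewrite !normrM.
  by apply: lerD; exact: ler_pM.
- have [g1 _ _] := HL _ (in_cube_upd j hx ht).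
  have dt : `|t - x j| <= 2 * a.
    by apply: le_trans (ler_normB _ _) _; have := hx j; lra.
  move: (h3 t ht) (l3 t ht); set D := t - x j.
  set rF := F _ - _ - _; set rG := G _ - _ - _ => hrF hrG.
  have -> : F (upd x j t) * G (upd x j t) - F x * G x
      - D * (F' x * G x + F x * G' x) = (F x + D * F' x) * rG +
        rF * G (upd x j t) + D ^+ 2 * (F' x * G' x) by rewrite /rF /rG; ring.
  have D2 := sqr_ge0 D.
  have e1 : `|(F x + D * F' x) * rG| <= (K + 2 * a * K) * (L * D ^+ 2).
    rewrite normrM ler_pM //; apply: le_trans (ler_normD _ _) (lerD h1 _).
    by rewrite normrM ler_pM.
  have e2 : `|rF * G (upd x j t)| <= K * D ^+ 2 * L by rewrite normrM ler_pM.
  have e3 : `|D ^+ 2 * (F' x * G' x)| <= D ^+ 2 * (K * L).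
    by rewrite normrM (ger0_norm D2) normrM ler_wpM2l // ler_pM.
  apply: le_trans (ler_normD _ _) _.
  apply: le_trans (lerD (ler_normD _ _) (lexx _)) _.
  have h5 := mulr_ge0 a_ge0 (mulr_ge0 KL0 D2).
  have h6 := mulr_ge0 KL0 D2.
  by lra.
Qed.

Lemma has_partial_cst j (c : R) : has_partial j (fun=> c) (fun=> 0).
Proof. exact: (@has_partial_indep _ _ `|c|). Qed.

Lemma has_partialZ j (c : R) F F' : has_partial j F F' ->
  has_partial j (fun x => c * F x) (fun x => c * F' x).
Proof.
move=> hF; apply: has_partial_ext (has_partialM (has_partial_cst j c) hF) => //.
by move=> x _; rewrite mul0r add0r.
Qed.

Lemma has_partial_sum (I : Type) (r : seq I) j (F F' : I -> _) :
  (forall i, has_partial j (F i) (F' i)) ->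
  has_partial j (fun x => \sum_(i <- r) F i x) (fun x => \sum_(i <- r) F' i x).
Proof.
move=> hF; elim: r => [|i r IH].
  by apply: has_partial_ext (has_partial_cst j 0) => x _; rewrite big_nil.
by apply: has_partial_ext (has_partialD (hF i) IH) => x _; rewrite big_cons.
Qed.

(** With [s i] the logarithmic derivative of [F i], the product rule becomes additive; this turns
    the derivative of a likelihood into a sum over samples. *)
Lemma has_partial_prod (I : Type) (r : seq I) j (F s : I -> ('I_h -> R) -> R) :
  (forall i, has_partial j (F i) (fun x => F i x * s i x)) ->
  has_partial j (fun x => \prod_(i <- r) F i x)
    (fun x => (\prod_(i <- r) F i x) * \sum_(i <- r) s i x).
Proof.
move=> hF; elim: r => [|i r IH].
  by apply: has_partial_ext (has_partial_cst j 1) => x _;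
    rewrite !big_nil ?mulr0.
apply: has_partial_ext (has_partialM (hF i) IH) => x _; rewrite !big_cons //.
by ring.
Qed.

(* Summed over a grid, the increments of [V j] in direction [j] telescope to the
   difference of its values on two opposite faces. *)
Lemma divergence_nonneg (V V' : 'I_h -> ('I_h -> R) -> R) (eta : R) :
  (forall j, has_partial j (V j) (V' j)) ->
  (forall j x, in_cube x -> `|x j| = a -> V j x = 0) -> 0 < a -> 0 < eta ->
  exists2 x, in_cube x & - eta <= \sum_j V' j x.
Proof.
move=> hV V0 apos eta0.
have /choice[K hK] : forall j, exists K : R, 0 <= K /\ forall x, in_cube x ->
    forall t, `|t| <= a ->
      V j (upd x j t) - V j x - (t - x j) * V' j x <= K * (t - x j) ^+ 2.
  move=> j; have [K K0 H] := hV j; exists K; split=> // x hx t ht.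
  by have [_ _ /(_ t ht)] := H x hx; apply: le_trans; exact: ler_norm.
pose S := \sum_j K j.
have S0 : 0 <= S by apply: sumr_ge0 => j _; have [] := hK j.
(* The mesh [D] is so fine that the accumulated remainders [D * S] stay below [eta]. *)
pose N := Num.truncn (2 * a * S / eta).
pose D := 2 * a / N.+1%:R.
have N0 : 0 < N.+1%:R :> R by rewrite ltr0n.
have D0 : 0 < D by rewrite divr_gt0 //; lra.
have DS : D * S < eta.
  have := truncnS_gt (2 * a * S / eta); rewrite -/N ltr_pdivrMr // => aS.
  rewrite (_ : D * S = 2 * a * S / N.+1%:R); last by rewrite /D; ring.
  by rewrite ltr_pdivrMr // [ltRHS]mulrC.
pose pt (k : nat) : R := - a + k%:R * D.
have NDa : N.+1%:R * D = 2 * a by rewrite /D mulrC divfK // gt_eqF.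
have pt_cube k : (k <= N.+1)%N -> `|pt k| <= a.
  move=> kN; have : (k%:R : R) * D <= N.+1%:R * D by rewrite ler_pM2r // ler_nat.
  have : 0 <= (k%:R : R) * D by rewrite mulr_ge0 // ltW.
  by rewrite NDa ler_norml /pt => ? ?; apply/andP; split; lra.
pose node (f : {ffun 'I_h -> 'I_N.+1}) : 'I_h -> R := fun i => pt (f i).
have node_cube f : in_cube (node f).
  by move=> i; apply: pt_cube; rewrite ltnW.
(* Nodes omit the right endpoint [a], and the shift is cyclic, hence a permutation of the nodes.
   Wrapping from the face [a] to the face [- a] is harmless because [V j] vanishes on both. *)
pose shift j (f : {ffun 'I_h -> 'I_N.+1}) : {ffun 'I_h -> 'I_N.+1} :=
  [ffun i => if i == j then ordS (f i) else f i].
have shift_inj j : injective (shift j).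
  move=> f g /ffunP fg; apply/ffunP => i; have := fg i; rewrite !ffunE.
  by case: ifP => // _ /ordS_inj.
have step j f : V j (upd (node f) j (pt (f j).+1)) = V j (node (shift j f)).
  have cu : in_cube (upd (node f) j (pt (f j).+1)).
    by apply: in_cube_upd => //; exact: pt_cube.
  have [fN|fN] := eqVneq (f j : nat) N; last first.
    congr (V j _); apply/funext => i; rewrite /upd /node ffunE.
    case: eqVneq => [->|//] /=; rewrite modn_small // ltnS ltn_neqAle fN.
    by rewrite -ltnS ltn_ord.
  rewrite !V0 // /upd /node ?ffunE ?eqxx /= ?fN ?modnn /pt ?NDa.
    by rewrite mul0r addr0 normrN gtr0_norm.
  by rewrite (_ : - a + 2 * a = a) ?gtr0_norm //; lra.
apply: contrapT => hno.
have neg x : in_cube x -> \sum_j V' j x < - eta.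
  by move=> hx; rewrite ltNge; apply/negP => hge; apply: hno; exists x.
have incr j f : V j (node (shift j f)) - V j (node f)
    <= D * (V' j (node f) + K j * D).
  have [_ /(_ _ (node_cube f) (pt (f j).+1) (pt_cube _ (ltn_ord _)))] := hK j.
  rewrite step (_ : pt (f j).+1 - node f j = D); last first.
    by rewrite /node /pt -natr1; ring.
  by lra.
(* The increments sum to zero by permutation, yet a divergence below [- eta] at every node would
   make the total at each node negative, since [D * S < eta]. *)
have : \sum_f \sum_j (V j (node (shift j f)) - V j (node f)) = 0.
  rewrite exchange_big big1 // => j _; rewrite sumrB.
  by rewrite [X in _ - X](reindex_inj (shift_inj j)) subrr.
apply/eqP; rewrite lt_eqF //.
have: \sum_(f : {ffun 'I_h -> 'I_N.+1}) \sum_j (V j (node (shift j f)) - V j (node f))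
    < \sum_(f : {ffun 'I_h -> 'I_N.+1}) 0.
  apply: ltr_sum => [|f _].
    by apply/hasP; exists [ffun=> ord0] => //; rewrite mem_index_enum.
  apply: le_lt_trans (ler_sum _ (fun j _ => incr j f)) _.
  rewrite -mulr_sumr big_split /= -mulr_suml -/S pmulr_rlt0 //.
  by have := neg _ (node_cube f); lra.
by rewrite [X in _ < X]big1.
Qed.

End CubeDivergence.

(** * Expectations under approximate differential privacy *)

Section PrivateScore.
Variable R : realType.

(** Follows from [expR u <= (1 - u)^-1], because multiplying the quadratic by [1 - u] gives
    [1 + u ^+ 2 * (1 - 2 * u)], at least 1. *)
Lemma expR_quad (u : R) : `|u| <= 1 / 2 -> expR u <= 1 + u + 2 * u ^+ 2.
Proof.
rewrite ler_norml => /andP[u1 u2].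
have h := expR_ge1Dx (- u).
have -> : expR u = (expR (- u))^-1 by rewrite expRN invrK.
have p : 0 < 1 - u by lra.
apply: (@le_trans _ _ (1 - u)^-1).
  by rewrite lef_pV2 ?posrE ?expR_gt0.
rewrite -[leLHS]mul1r ler_pdivrMr //.
have -> : (1 + u + 2 * u ^+ 2) * (1 - u) = 1 + u ^+ 2 * (1 - 2 * u) by ring.
by rewrite lerDl mulr_ge0 ?sqr_ge0 //; lra.
Qed.

Lemma expR_half_le2 : expR (1 / 2 : R) <= 2.
Proof.
have := expR_ge1Dx (- (1 / 2 : R)); rewrite expRN => h.
have : (2 : R)^-1 <= (expR (1 / 2))^-1 by lra.
by rewrite lef_pV2 ?posrE ?expR_gt0.
Qed.

Section Events.
Variables (V : finType) (Q Q' : V -> R) (eps delta : R).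

Definition dp_events := forall A : {set V},
  \sum_(v in A) Q v <= expR eps * \sum_(v in A) Q' v + delta.

(** The set [A] carries the whole positive part of [Q - expR eps * Q'], so privacy on this single
    event, weighted by at most [B], suffices. *)
Lemma dp_expect (f : V -> R) (B : R) : dp_events -> 0 <= B ->
  (forall v, 0 <= f v <= B) ->
  \sum_v Q v * f v <= expR eps * \sum_v Q' v * f v + delta * B.
Proof.
move=> dp B0 hf; pose A := [set v | expR eps * Q' v <= Q v]%SET.
have H : \sum_v (Q v - expR eps * Q' v) * f v
    <= B * \sum_(v in A) (Q v - expR eps * Q' v).
  rewrite (bigID (mem A)) /= mulr_sumr -[leRHS]addr0; apply: lerD.
    apply: ler_sum => v; rewrite inE => Av.
    by rewrite mulrC ler_wpM2r ?subr_ge0 //; case/andP: (hf v).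
  apply: sumr_le0 => v; rewrite inE -ltNge => /ltW Av.
  by rewrite mulr_le0_ge0 ?subr_le0 //; case/andP: (hf v).
have D : \sum_(v in A) (Q v - expR eps * Q' v) <= delta.
  by rewrite sumrB -mulr_sumr; have := dp A; lra.
have := le_trans H (ler_wpM2l B0 D).
under eq_bigr do rewrite mulrBl -mulrA.
by rewrite sumrB -mulr_sumr; lra.
Qed.

End Events.

(* Above the level [eps / lam], the excess of [f] is at most
   [expR (lam * f - eps) / lam], and the factor [expR (- eps)] pays for the
   privacy loss. *)
Lemma dp_expect_exp (V : finType) (Q Q' : V -> R) (eps delta lam B : R)
    (f : V -> R) : 0 < lam -> 0 <= B -> 0 <= eps -> 0 <= delta ->
  (forall v, 0 <= Q v) -> (forall v, 0 <= Q' v) -> \sum_v Q v = 1 ->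
  dp_events Q Q' eps delta -> (forall v, `|f v| <= B) ->
  \sum_v Q v * f v <=
    lam^-1 * (eps + \sum_v Q' v * expR (lam * f v)) + delta * B.
Proof.
move=> l0 B0 e0 d0 Q0 Q'0 Q1 dp fB.
pose T := eps / lam.
have T0 : 0 <= T by rewrite divr_ge0 // ltW.
pose g v := Num.max 0 (f v - T).
have g0 v : 0 <= g v by rewrite le_max lexx.
have gB v : g v <= B.
  by rewrite ge_max B0 /=; have := fB v; rewrite ler_norml => /andP[]; lra.
have := @dp_expect V Q Q' eps delta g B dp B0 (fun v => introT andP (conj (g0 v) (gB v))).
have H1 : \sum_v Q v * f v <= T + \sum_v Q v * g v.
  rewrite -[T]mulr1 -Q1 mulr_sumr -big_split /=; apply: ler_sum => v _.
  rewrite [T * _]mulrC -mulrDr ler_wpM2l //.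
  have : f v - T <= g v by rewrite le_max lexx orbT.
  lra.
have H2 : expR eps * \sum_v Q' v * g v <= lam^-1 * \sum_v Q' v * expR (lam * f v).
  rewrite !mulr_sumr; apply: ler_sum => v _.
  rewrite mulrCA [leRHS]mulrCA ler_wpM2l //.
  rewrite -[leRHS]mulrC ler_pdivlMr //.
  have -> : lam * f v = eps + lam * (f v - T) by rewrite /T; field; rewrite gt_eqF.
  rewrite expRD -mulrA ler_wpM2l ?expR_ge0 // mulrC /g maxr_pMr ?(ltW l0) //.
  rewrite mulr0 ge_max expR_ge0 /=.
  by have := expR_ge1Dx (lam * (f v - T)); lra.
by rewrite mulrDr /T in H1 *; rewrite mulrC in H1; lra.
Qed.

(** Complements [dp_expect_exp] for small [eps]: apart from the [delta] term, the loss vanishes with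
    [eps]. The positive and negative parts of [f] use privacy in opposite directions. *)
Lemma dp_expect_abs (V : finType) (Q Q' : V -> R) (eps delta B : R)
    (f : V -> R) : 0 <= B -> 0 <= eps -> 0 <= delta ->
  (forall v, 0 <= Q v) -> (forall v, 0 <= Q' v) ->
  dp_events Q Q' eps delta -> dp_events Q' Q eps delta ->
  (forall v, `|f v| <= B) ->
  \sum_v Q v * f v <= \sum_v Q' v * f v +
    (expR eps - 1) * \sum_v Q' v * `|f v| + 2 * delta * B.
Proof.
move=> B0 e0 d0 Q0 Q'0 dp dp' fB.
pose g v := Num.max 0 (f v); pose k v := Num.max 0 (- f v).
have fgk v : f v = g v - k v /\ `|f v| = g v + k v.
  rewrite /g /k; case: (lerP 0 (f v)) => hf.
    by rewrite max_l ?oppr_le0 // ger0_norm //; split; lra.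
  by rewrite max_r ?oppr_ge0 ?ltW // ltr0_norm //; split; lra.
have gk0 v : 0 <= g v /\ 0 <= k v by rewrite !le_max !lexx.
have gkB v : 0 <= g v <= B /\ 0 <= k v <= B.
  by have [? ?] := gk0 v; have [_ e] := fgk v; have := fB v; rewrite e; split;
    apply/andP; split; lra.
have H1 := @dp_expect V Q Q' eps delta g B dp B0 (fun v => (gkB v).1).
have H2 := @dp_expect V Q' Q eps delta k B dp' B0 (fun v => (gkB v).2).
have E1 (P : V -> R) : \sum_v P v * f v = \sum_v P v * g v - \sum_v P v * k v.
  by rewrite -sumrB; apply: eq_bigr => v _; rewrite -mulrBr -(fgk v).1.
have E2 (P : V -> R) : \sum_v P v * `|f v| = \sum_v P v * g v + \sum_v P v * k v.
  by rewrite -big_split; apply: eq_bigr => v _; rewrite /= -mulrDr -(fgk v).2.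
rewrite !E1 E2.
have e1 : 1 <= expR eps by rewrite -expR0 ler_expR.
have k0 : 0 <= \sum_v Q v * k v by apply: sumr_ge0 => v _; rewrite mulr_ge0 //; case: (gk0 v).
have k'0 : 0 <= \sum_v Q' v * k v by apply: sumr_ge0 => v _; rewrite mulr_ge0 //; case: (gk0 v).
move: H1 H2 e1 k0 k'0; set x := expR eps; set A := \sum_v Q v * g v.
set A' := \sum_v Q' v * g v; set K := \sum_v Q v * k v.
set K' := \sum_v Q' v * k v => H1 H2 x1 K0 K'0.
have dB : 0 <= delta * B by exact: mulr_ge0.
(* [K' <= x K + d] gives [K >= K' - (x - 1) K' - d] as [1/x >= 2 - x]. *)
have : K' - (x - 1) * K' - delta * B <= K.
  have h := mulr_ge0 (mulr_ge0 K'0 (sqr_ge0 (x - 1))) ler01.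
  rewrite -(@ler_pM2l _ x); last lra.
  have := mulr_ge0 dB (_ : 0 <= x - 1); nra.
lra.
Qed.

(** * Independent samples and the expected score of one user *)

Section Mechanism.
Variables (T V : finType) (n m : nat) (p : T -> R).
Hypotheses (p0 : forall k, 0 <= p k) (p1 : \sum_k p k = 1).

Definition data_prob (X : 'M[T]_(n, m)) : R :=
  \prod_(i < n) \prod_(l < m) p (X i l).

Definition row_prob (r : {ffun 'I_m -> T}) : R := \prod_(l < m) p (r l).

Lemma row_prob_ge0 r : 0 <= row_prob r.
Proof. exact: prodr_ge0. Qed.

Lemma data_prob_ge0 X : 0 <= data_prob X.
Proof. by apply: prodr_ge0 => i _; exact: prodr_ge0. Qed.

Lemma sum_row_prob : \sum_r row_prob r = 1.
Proof.
rewrite /row_prob -(bigA_distr_bigA (fun _ k => p k)) /=.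
by rewrite big1 // => i _.
Qed.

Lemma sum_data_prob : \sum_X data_prob X = 1.
Proof.
pose g (f : {ffun 'I_n -> {ffun 'I_m -> T}}) : 'M[T]_(n, m) :=
  \matrix_(i, l) f i l.
pose g' (X : 'M[T]_(n, m)) := [ffun i => [ffun l => X i l]].
have gK : cancel g g'.
  by move=> f; apply/ffunP => i; rewrite ffunE; apply/ffunP => l; rewrite ffunE mxE.
have g'K : cancel g' g by move=> X; apply/matrixP => i l; rewrite mxE !ffunE.
rewrite (reindex g) /=; last by exists g' => f _; [exact: gK|exact: g'K].
rewrite /data_prob; under eq_bigr do under eq_bigr do under eq_bigr do rewrite mxE.
rewrite -(bigA_distr_bigA (fun _ r => row_prob r)) /=.
by rewrite big1 // => i _; exact: sum_row_prob.
Qed.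

Definition set_row (X : 'M[T]_(n, m)) (i : 'I_n) (r : {ffun 'I_m -> T}) :=
  (\matrix_(i', l) if i' == i then r l else X i' l) : 'M[T]_(n, m).

Definition get_row (X : 'M[T]_(n, m)) (i : 'I_n) := [ffun l => X i l].

Lemma data_prob_row X i : data_prob X =
  row_prob (get_row X i) * \prod_(i' | i' != i) \prod_(l < m) p (X i' l).
Proof.
rewrite /data_prob (bigD1 i) //=; congr (_ * _).
by apply: eq_bigr => l _; rewrite ffunE.
Qed.

(** Exchanging row [i] with an independent fresh row is an involution that preserves the joint
    law. *)
Lemma swap_row i (G : 'M[T]_(n, m) -> {ffun 'I_m -> T} -> R) :
  \sum_X \sum_r data_prob X * row_prob r * G X r =
  \sum_X \sum_r data_prob X * row_prob r * G (set_row X i r) (get_row X i).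
Proof.
pose s (u : 'M[T]_(n, m) * {ffun 'I_m -> T}) :=
  (set_row u.1 i u.2, get_row u.1 i).
have sK : involutive s.
  move=> [X r]; congr (_, _) => /=.
    by apply/matrixP => i' l; rewrite !mxE !ffunE; case: eqP => [->|].
  by apply/ffunP => l; rewrite !ffunE mxE eqxx.
rewrite !pair_bigA /= (reindex_inj (inv_inj sK)) /=.
apply: eq_bigr => -[X r] _ /=; congr (_ * _).
have -> : data_prob (set_row X i r) =
    row_prob r * \prod_(i' | i' != i) \prod_(l < m) p (X i' l).
  rewrite (data_prob_row _ i); congr (_ * _).
    by apply: eq_bigr => l _; rewrite ffunE mxE eqxx.
  by apply: eq_bigr => i' /negPf ii; apply: eq_bigr => l _; rewrite mxE ii.
by rewrite (data_prob_row X i); ring.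
Qed.

Lemma row_mean0 (xi : T -> R) : \sum_k p k * xi k = 0 ->
  \sum_r row_prob r * \sum_(l < m) xi (r l) = 0.
Proof.
move=> xi0; under eq_bigr do rewrite mulr_sumr.
rewrite exchange_big big1 //= => l0 _.
(* Inserting [xi] in the factor [l0] alone lets the sum over rows factor over samples, and that one
   factor vanishes. *)
pose F (l : 'I_m) k := p k * (if l == l0 then xi k else 1).
rewrite (eq_bigr (fun r : {ffun 'I_m -> T} => \prod_(l < m) F l (r l))).
  rewrite -(bigA_distr_bigA F) (bigD1 l0) //= /F.
  by under eq_bigr do rewrite eqxx; rewrite xi0 mul0r.
move=> r _; rewrite /F big_split /=; congr (_ * _).
rewrite (bigD1 l0) //= eqxx big1 ?mulr1 // => l /negPf ll0.
by rewrite ll0.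
Qed.

(** The linear term is centred, so [expR_quad] bounds the moment of one sample by
    [1 + (2 * m%:R)^-1]; independence raises this to the power [m], which is at most
    [expR (1 / 2)]. *)
Lemma row_mgf (u : T -> R) : (0 < m)%N ->
  (forall k, `|u k| <= 1 / 2) -> (forall k, u k ^+ 2 <= (4 * m%:R)^-1) ->
  \sum_k p k * u k = 0 ->
  \sum_r row_prob r * expR (\sum_(l < m) u (r l)) <= 2.
Proof.
move=> m0 u1 u2 u3.
have mR : 0 < m%:R :> R by rewrite ltr0n.
rewrite (eq_bigr (fun r : {ffun 'I_m -> T} => \prod_(l < m) (p (r l) * expR (u (r l))))); last first.
  by move=> r _; rewrite expR_sum big_split.
rewrite -(bigA_distr_bigA (fun _ k => p k * expR (u k))) /=.
rewrite prodr_const card_ord.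
have q0 : 0 <= \sum_k p k * expR (u k).
  by apply: sumr_ge0 => k _; rewrite mulr_ge0 ?expR_ge0.
have q1 : \sum_k p k * expR (u k) <= expR ((2 * m%:R)^-1).
  apply: le_trans (expR_ge1Dx _).
  apply: (@le_trans _ _ (\sum_k (p k + p k * u k + p k * (2 * m%:R)^-1))).
    apply: ler_sum => k _; rewrite -[X in X + _ + _]mulr1 -!mulrDr ler_wpM2l //.
    apply: le_trans (expR_quad (u1 k)) _; rewrite lerD2l.
    have := u2 k; rewrite !invfM; lra.
  by rewrite !big_split /= -mulr_suml p1 u3 mul1r addr0.
apply: le_trans (lerXn2r m _ _ q1) _; rewrite ?nnegrE ?expR_ge0 //.
rewrite -expRM_natl (_ : m%:R * _ = 1 / 2); last first.
  by field; rewrite gt_eqF.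
exact: expR_half_le2.
Qed.

Variables (Q : 'M[T]_(n, m) -> V -> R) (eps delta : R).
Hypotheses (Q0 : forall X v, 0 <= Q X v) (Q1 : forall X, \sum_v Q X v = 1).
Hypothesis Qdp : forall X i r, dp_events (Q X) (Q (set_row X i r)) eps delta /\
  dp_events (Q (set_row X i r)) (Q X) eps delta.

(** Privacy lets the mechanism see a fresh row instead of the scored one, and then the score is
    centred with fluctuations of order [b * Num.sqrt m%:R]. Small [eps] goes through
    [dp_expect_abs], which keeps the bound linear in [eps]; large [eps] through [dp_expect_exp]. *)
Lemma user_score_le (xi : V -> T -> R) (b : R) (i : 'I_n) :
  (0 < m)%N -> 0 < eps -> 0 <= delta -> 0 < b ->
  (forall v k, `|xi v k| <= b) -> (forall v, \sum_k p k * xi v k = 0) ->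
  \sum_X data_prob X * \sum_v Q X v * \sum_(l < m) xi v (X i l) <=
    16 * eps * b * Num.sqrt m%:R + 2 * delta * (b * m%:R).
Proof.
move=> m0 e0 d0 b0 xib xi0.
have mR : 1 <= m%:R :> R by rewrite ler1n.
pose sm : R := Num.sqrt m%:R.
have sm1 : 1 <= sm by rewrite -sqrtr1 ler_sqrt // ltW.
have smE : sm ^+ 2 = m%:R by rewrite sqr_sqrtr // ltW.
(* This scale brings one sample's score down to [(2 * sm)^-1], whose square is exactly what
   [row_mgf] allows. *)
pose lam := (2 * b * sm)^-1.
have bs0 : 0 < 2 * b * sm by rewrite !mulr_gt0 //; lra.
have lam0 : 0 < lam by rewrite invr_gt0.
have lamb : lam * b = (2 * sm)^-1.
  by rewrite /lam; field; rewrite !gt_eqF //; lra.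
pose Z v (r : {ffun 'I_m -> T}) := \sum_(l < m) xi v (r l).
have ZB v r : `|Z v r| <= b * m%:R.
  apply: le_trans (ler_norm_sum _ _ _) _.
  apply: le_trans (ler_sum _ (fun l _ => xib v (r l))) _.
  by rewrite sumr_const card_ord mulr_natr.
have B0 : 0 <= b * m%:R by rewrite mulr_ge0 ?ltW //; lra.
have mgf v c : `|c| = lam -> \sum_r row_prob r * expR (c * Z v r) <= 2.
  move=> clam; under eq_bigr do rewrite mulr_sumr.
  have cu k : `|c * xi v k| <= (2 * sm)^-1.
    by rewrite normrM clam -lamb ler_pM2l.
  apply: (@row_mgf (fun k => c * xi v k)) => // [k|k|].
  - apply: le_trans (cu k) _; rewrite div1r lef_pV2 ?posrE //; lra.
  - rewrite -real_normK ?num_real //.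
    apply: le_trans (lerXn2r 2 _ _ (cu k)) _; rewrite ?nnegrE //.
      by rewrite invr_ge0; lra.
    by rewrite exprVn exprMn smE; lra.
  - under eq_bigr do rewrite mulrCA.
    by rewrite -mulr_sumr xi0 mulr0.
pose avg (G : 'M[T]_(n, m) -> {ffun 'I_m -> T} -> R) :=
  \sum_X \sum_r data_prob X * row_prob r * G X r.
have avg_le G H : (forall X r, G X r <= H X r) -> avg G <= avg H.
  move=> GH; apply: ler_sum => X _; apply: ler_sum => r _.
  by rewrite ler_wpM2l // mulr_ge0 ?data_prob_ge0 ?row_prob_ge0.
have avgD G H : avg (fun X r => G X r + H X r) = avg G + avg H.
  rewrite /avg -big_split /=; apply: eq_bigr => X _.
  by rewrite -big_split /=; apply: eq_bigr => r _; rewrite mulrDr.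
have avgZ c G : avg (fun X r => c * G X r) = c * avg G.
  rewrite /avg mulr_sumr; apply: eq_bigr => X _.
  by rewrite mulr_sumr; apply: eq_bigr => r _; rewrite mulrCA.
have avg_cst c : avg (fun _ _ => c) = c.
  rewrite /avg; under eq_bigr do rewrite -mulr_suml -mulr_sumr sum_row_prob mulr1.
  by rewrite -mulr_suml sum_data_prob mul1r.
(* Expectation when the mechanism does not see the row [r] being scored. *)
have fresh (f : V -> {ffun 'I_m -> T} -> R) c :
    (forall v, \sum_r row_prob r * f v r <= c) ->
    avg (fun X r => \sum_v Q (set_row X i r) v * f v (get_row X i)) <= c.
  move=> fc.
  rewrite /avg -(@swap_row i (fun X r => \sum_v Q X v * f v r)).
  rewrite -[leRHS](mul1r c) -sum_data_prob mulr_suml; apply: ler_sum => X _.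
  under eq_bigr do rewrite -mulrA; rewrite -mulr_sumr ler_wpM2l ?data_prob_ge0 //.
  under eq_bigr do rewrite mulr_sumr; rewrite exchange_big /=.
  rewrite -[leRHS]mul1r -(Q1 X) mulr_suml; apply: ler_sum => v _.
  by under eq_bigr do rewrite mulrCA; rewrite -mulr_sumr ler_wpM2l.
have -> : \sum_X data_prob X * \sum_v Q X v * \sum_(l < m) xi v (X i l) =
    avg (fun X r => \sum_v Q X v * Z v (get_row X i)).
  apply: eq_bigr => X _; rewrite -mulr_suml -mulr_sumr sum_row_prob mulr1.
  congr (_ * _); apply: eq_bigr => v _; congr (_ * _).
  by apply: eq_bigr => l _; rewrite ffunE.
have mean : avg (fun X r => \sum_v Q (set_row X i r) v * Z v (get_row X i)) <= 0.
  by apply: (fresh Z) => v; rewrite row_mean0.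
have dB : 0 <= delta * (b * m%:R) by exact: mulr_ge0.
have bsm : 0 < b * sm by rewrite mulr_gt0 //; lra.
have [eps_small|eps_big] := lerP eps (1 / 2).
- have ebs : 0 < eps * (b * sm) by exact: mulr_gt0.
  have habs : avg (fun X r =>
      \sum_v Q (set_row X i r) v * `|Z v (get_row X i)|) <= 8 * (b * sm).
    apply: (fresh (fun v r => `|Z v r|)) => v.
    (* Two-sided exponential moments control the absolute value: [lam * |z|] is at most
       [expR (lam * z) + expR (- lam * z)]. *)
    have H r : row_prob r * `|Z v r| <= (2 * b * sm) *
        (row_prob r * expR (lam * Z v r) + row_prob r * expR (- lam * Z v r)).
      rewrite -mulrDr mulrCA ler_wpM2l ?row_prob_ge0 //.
      rewrite -[2 * b * sm]invrK -/lam mulrC ler_pdivlMr //.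
      have h1 := expR_ge1Dx (lam * Z v r); have h2 := expR_ge1Dx (- lam * Z v r).
      have h3 := expR_gt0 (lam * Z v r); have h4 := expR_gt0 (- lam * Z v r).
      by rewrite mulNr in h2 h4 *; case: (lerP 0 (Z v r)) => hz;
        [rewrite ger0_norm|rewrite ltr0_norm]; lra.
    apply: le_trans (ler_sum _ (fun r _ => H r)) _.
    rewrite -mulr_sumr big_split /=.
    have m1 : \sum_r row_prob r * expR (lam * Z v r) <= 2.
      by apply: mgf; rewrite gtr0_norm.
    have m2 : \sum_r row_prob r * expR (- lam * Z v r) <= 2.
      by apply: mgf; rewrite normrN gtr0_norm.
    rewrite (_ : 8 * (b * sm) = 2 * b * sm * 4); last by ring.
    by rewrite ler_wpM2l ?(ltW bs0) //; lra.
  have ee : expR eps - 1 <= 2 * eps.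
    have := @expR_quad eps; rewrite ger0_norm ?(ltW e0) // => /(_ eps_small).
    by have := mulr_ge0 (ltW e0) (_ : 0 <= 1 / 2 - eps); nra.
  have e1 : 0 <= expR eps - 1 by rewrite subr_ge0 -expR0 ler_expR ltW.
  have key := avg_le _ _ (fun X r => dp_expect_abs B0 (ltW e0) d0 (Q0 X)
    (Q0 (set_row X i r)) (Qdp X i r).1 (Qdp X i r).2
    (fun v => ZB v (get_row X i))).
  apply: le_trans key _; rewrite !avgD avgZ avg_cst.
  have := le_trans (ler_wpM2l e1 habs) (ler_wpM2r (_ : 0 <= 8 * (b * sm)) ee).
  rewrite -/sm; nra.
(* The bound obtained is [2 * b * sm * (eps + 2)], and [eps > 1 / 2] absorbs the constant 2 into a
   multiple of [eps]. *)
- have key := avg_le _ _ (fun X r => dp_expect_exp lam0 B0 (ltW e0) d0 (Q0 X)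
    (Q0 (set_row X i r)) (Q1 X) (Qdp X i r).1 (fun v => ZB v (get_row X i))).
  apply: le_trans key _; rewrite avgD avg_cst avgZ avgD avg_cst.
  have := fresh (fun v r => expR (lam * Z v r)) 2 (fun v => mgf v _ (gtr0_norm lam0)).
  rewrite /lam invrK -/lam -/sm; nra.
Qed.

End Mechanism.

End PrivateScore.

(** * The hard family of distributions *)

Section HardFamily.
Variables (R : realType) (d : nat).
Hypothesis d2 : (2 <= d)%N.
Local Notation h := d./2.
Implicit Types (j : 'I_h) (k : 'I_d) (x : 'I_h -> R).

(* Coordinates [2j] and [2j+1] form the [j]-th pair; for odd [d] the last
   coordinate is unpaired. *)
Definition pair_sign j k : R := (k./2 == j)%:R * (-1) ^+ odd k.

Definition tilt x k : R := 1 + \sum_j x j * pair_sign j k.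

Definition hard_dist x k : R := tilt x k / d%:R.

Let dR : 0 < d%:R :> R. Proof. by rewrite ltr0n; case: d d2. Qed.

Lemma half_dim_ge : d%:R <= 3 * h%:R :> R.
Proof.
rewrite -natrM ler_nat -{1}(odd_double_half d) -muln2.
by case: d d2 => [|[|[|k]]] //= _; case: odd => //=; lia.
Qed.

Lemma normr_pair_sign j k : `|pair_sign j k| = (k./2 == j)%:R.
Proof. by rewrite normrM normr_sign mulr1 normr_nat. Qed.

(** Each point lies in at most one pair, which keeps sums over [j] from growing with [h]. *)
Lemma sum_pair_sign_le1 k : \sum_j `|pair_sign j k| <= 1.
Proof.
under eq_bigr do rewrite normr_pair_sign.
have [kh|kh] := ltnP k./2 h.
  rewrite (bigD1 (Ordinal kh)) //= eqxx big1 ?addr0 // => j jk.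
  by rewrite (_ : _ == _ = false) //; apply: contraNF jk => /eqP e; apply/eqP/val_inj.
rewrite big1 // => j _; rewrite (_ : _ == _ = false) //.
by apply/negP => /eqP e; move: kh; rewrite e leqNgt ltn_ord.
Qed.

Lemma sum_pair_sign j (F : 'I_d -> R) : exists k0 k1 : 'I_d,
  [/\ (k0 : nat) = j.*2, (k1 : nat) = j.*2.+1 &
    \sum_k pair_sign j k * F k = F k0 - F k1].
Proof.
have jd : (j.*2.+1 < d)%N.
  by have := odd_double_half d; have := ltn_ord j; rewrite -!muln2; lia.
exists (Ordinal (ltnW jd)), (Ordinal jd); split=> //.
rewrite (bigD1 (Ordinal (ltnW jd))) //= (bigD1 (Ordinal jd)) //=; last first.
  by rewrite -val_eqE /= gtn_eqF.
rewrite big1 => [|k /andP[k0 k1]].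
  rewrite /pair_sign /= odd_double doubleK uphalf_double eqxx /= expr0 expr1; ring.
rewrite /pair_sign (_ : _ == _ = false) ?mul0r //; apply/negP => /eqP kj.
move: k0 k1; rewrite -!val_eqE /= -kj; have := odd_double_half k.
by rewrite -!muln2; case: (odd k); lia.
Qed.

Lemma sum_pair_sign0 j : \sum_k pair_sign j k = 0.
Proof.
have [k0 [k1 [_ _ E]]] := sum_pair_sign j (fun=> 1).
by under eq_bigr do rewrite -[pair_sign _ _]mulr1; rewrite E subrr.
Qed.

Lemma pair_sign_orth j j' :
  \sum_k pair_sign j k * pair_sign j' k = 2 * (j == j')%:R.
Proof.
have [k0 [k1 [e0 e1 ->]]] := sum_pair_sign j (pair_sign j').
rewrite /pair_sign e0 e1 /= odd_double doubleK uphalf_double /= expr0 expr1.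
rewrite -val_eqE /=; ring.
Qed.

Lemma tilt_dev a x k : in_cube a x -> `|\sum_j x j * pair_sign j k| <= a.
Proof.
move=> hx; have a0 : 0 <= a.
  have h0 : (0 < h)%N by rewrite half_gt0.
  exact: le_trans (normr_ge0 _) (hx (Ordinal h0)).
apply: le_trans (ler_norm_sum _ _ _) _.
rewrite -[leRHS]mulr1; apply: le_trans (ler_wpM2l a0 (sum_pair_sign_le1 k)).
by rewrite mulr_sumr; apply: ler_sum => j _; rewrite normrM ler_wpM2r.
Qed.

Lemma tilt_ge a x k : a <= 1 / 2 -> in_cube a x -> 1 / 2 <= tilt x k.
Proof.
by move=> a2 /(@tilt_dev _ _ k); rewrite ler_norml => /andP[]; rewrite /tilt; lra.
Qed.

Lemma hard_dist_ge0 a x k : a <= 1 / 2 -> in_cube a x -> 0 <= hard_dist x k.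
Proof.
by move=> a2 hx; apply: divr_ge0 => //; apply: le_trans (tilt_ge k a2 hx); lra.
Qed.

Lemma sum_hard_dist x : \sum_k hard_dist x k = 1.
Proof.
rewrite -mulr_suml big_split /= sumr_const card_ord exchange_big /=.
rewrite [X in _ + X]big1 => [|j _]; last by rewrite -mulr_sumr sum_pair_sign0 mulr0.
by rewrite addr0 divff // gt_eqF.
Qed.

Lemma sum_pair_sign_hard x j : \sum_k pair_sign j k * hard_dist x k = 2 * x j / d%:R.
Proof.
under eq_bigr do rewrite mulrA; rewrite -mulr_suml; congr (_ / _).
under eq_bigr do rewrite mulrDr mulr1.
rewrite big_split /= sum_pair_sign0 add0r.
under eq_bigr do rewrite mulr_sumr.
rewrite exchange_big /= (bigD1 j) //= [X in _ + X]big1 => [|j' jj'].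
  under eq_bigr do rewrite mulrCA.
  by rewrite -mulr_sumr pair_sign_orth eqxx mulr1 addr0 mulrC.
under eq_bigr do rewrite mulrCA.
by rewrite -mulr_sumr pair_sign_orth eq_sym (negPf jj') !mulr0.
Qed.

Definition pm (b : bool) : R := if b then 1 else -1.

(** The contrast of the [j]-th pair under [hard_dist x] is [2 * x j / d%:R], so its sign on [y] is a
    guess for the sign of [x j]. *)
Definition pattern (y : 'I_d -> R) : {ffun 'I_h -> bool} :=
  [ffun j => 0 <= \sum_k pair_sign j k * y k].

(* A wrong sign in coordinate [j] forces an error of at least [2 |x j| / d] on
   the [j]-th pair. *)
Lemma pattern_accurate x y :
  \sum_j `|x j| - d%:R * \sum_k `|y k - hard_dist x k| <=
  \sum_j x j * pm (pattern y j).
Proof.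
pose c j := \sum_k `|pair_sign j k| * `|y k - hard_dist x k|.
have cj j : `|x j| - d%:R * c j <= x j * pm (pattern y j).
  have : `|\sum_k pair_sign j k * y k - 2 * x j / d%:R| <= c j.
    rewrite -sum_pair_sign_hard -sumrB; under eq_bigr do rewrite -mulrBr.
    apply: le_trans (ler_norm_sum _ _ _) _.
    by under eq_bigr do rewrite normrM.
  rewrite /pattern ffunE /pm; set s := \sum_k _ => sc.
  have sc' : d%:R * `|s - 2 * x j / d%:R| <= d%:R * c j by rewrite ler_pM2l.
  have dsE : d%:R * (s - 2 * x j / d%:R) = d%:R * s - 2 * x j.
    by field; rewrite gt_eqF.
  rewrite -[X in X * `|_|](gtr0_norm dR) -normrM dsE in sc'.
  move: sc'; rewrite ler_norml => /andP[s1 s2].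
  have c0 : 0 <= d%:R * c j.
    by apply: mulr_ge0; [exact: ltW|apply: sumr_ge0 => k _; exact: mulr_ge0].
  case: (lerP 0 s) => s0; case: (lerP 0 (x j)) => x0.
  - by rewrite ger0_norm //; lra.
  - by rewrite ltr0_norm //; have := mulr_ge0 (ltW dR) s0; lra.
  - by rewrite ger0_norm //; have := mulr_ge0_le0 (ltW dR) (ltW s0); lra.
  - by rewrite ltr0_norm //; lra.
apply: le_trans (ler_sum _ (fun j _ => cj j)).
rewrite sumrB lerD2l lerN2 -mulr_sumr ler_pM2l // exchange_big /=.
apply: ler_sum => k _; rewrite -mulr_suml -[leRHS]mul1r ler_wpM2r //.
exact: sum_pair_sign_le1.
Qed.

(** * Likelihood scores and the fingerprinting inequality *)

Section Score.
Variables (a : R) (n m : nat).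
Hypotheses (a0 : 0 < a) (a2 : a <= 1 / 2).

(** Written with the logarithmic derivative [pair_sign j k / tilt x k], the shape that
    [has_partial_prod] expects. *)
Lemma has_partial_hard j k : has_partial a j (fun x => hard_dist x k)
  (fun x => hard_dist x k * (pair_sign j k / tilt x k)).
Proof.
have S : has_partial a j (fun x => \sum_j' x j' * pair_sign j' k)
    (fun x => \sum_j' (if j' == j then pair_sign j' k else 0)).
  apply: has_partial_sum => j'.
  have [->|jj] := eqVneq j' j.
    apply: has_partial_ext (has_partialZ (ltW a0) (pair_sign j k)
      (has_partial_coord j (ltW a0))) => x _; by rewrite ?mulr1 // mulrC.
  apply: (@has_partial_indep _ _ _ _ _ a) => [x hx|x t]; last first.
    by rewrite /upd (negPf jj).
  rewrite normrM -[leRHS]mulr1 ler_pM //.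
  by rewrite normr_pair_sign lern1; case: eqP.
have := has_partialZ (ltW a0) d%:R^-1 (has_partialD (has_partial_cst a j 1) S).
apply: has_partial_ext => x hx; first by rewrite mulrC.
have t0 := tilt_ge k a2 hx.
rewrite add0r -big_mkcond /= big_pred1_eq /hard_dist; field.
by rewrite !gt_eqF //; lra.
Qed.

Lemma has_partial_data j (X : 'M['I_d]_(n, m)) :
  has_partial a j (fun x => data_prob (hard_dist x) X)
  (fun x => data_prob (hard_dist x) X *
     \sum_(i < n) \sum_(l < m) pair_sign j (X i l) / tilt x (X i l)).
Proof.
apply: has_partial_prod => [|i]; first exact: ltW.
apply: has_partial_prod => [|l]; first exact: ltW.
exact: has_partial_hard.
Qed.

Local Notation V := {ffun 'I_h -> bool}.

Variables (Q : 'M['I_d]_(n, m) -> V -> R) (eps delta err : R).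
Hypotheses (Q0 : forall X v, 0 <= Q X v) (Q1 : forall X, \sum_v Q X v = 1).
Hypothesis Qdp : forall X i r, dp_events (Q X) (Q (set_row X i r)) eps delta /\
  dp_events (Q (set_row X i r)) (Q X) eps delta.
Hypothesis Qerr : forall x, in_cube a x ->
  \sum_j `|x j| - err <=
  \sum_X data_prob (hard_dist x) X * \sum_v Q X v * \sum_j x j * pm (v j).

Definition mean_sign j (X : 'M['I_d]_(n, m)) : R := \sum_v Q X v * pm (v j).

Definition est j x : R := \sum_X data_prob (hard_dist x) X * mean_sign j X.

Definition dest j x : R := \sum_X data_prob (hard_dist x) X *
  (\sum_(i < n) \sum_(l < m) pair_sign j (X i l) / tilt x (X i l)) *
  mean_sign j X.

Lemma has_partial_est j : has_partial a j (est j) (dest j).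
Proof.
apply: has_partial_sum => X.
apply: has_partial_ext (has_partialZ (ltW a0) (mean_sign j X)
  (has_partial_data j X)) => x _; by rewrite mulrC.
Qed.

(** The log-likelihood gradient at one sample, paired with the guessed signs and with weights that
    vanish on the faces of the cube. *)
Definition score x (v : V) k : R :=
  \sum_j (a ^+ 2 - x j ^+ 2) * pm (v j) * (pair_sign j k / tilt x k).

(** At most one pair contains [k]; its weight is at most [a ^+ 2], and [tilt x k >= 1 / 2] costs the
    factor 2. *)
Lemma score_le x v k : in_cube a x -> `|score x v k| <= 2 * a ^+ 2.
Proof.
move=> hx; have t0 := tilt_ge k a2 hx.
apply: le_trans (ler_norm_sum _ _ _) _.
have -> : 2 * a ^+ 2 = 2 * a ^+ 2 * 1 by rewrite mulr1.
apply: le_trans (ler_wpM2l _ (sum_pair_sign_le1 k)); last first.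
  by rewrite mulr_ge0 ?sqr_ge0.
rewrite mulr_sumr; apply: ler_sum => j _.
have w : `|a ^+ 2 - x j ^+ 2| <= a ^+ 2.
  have : x j ^+ 2 <= a ^+ 2.
    by rewrite -real_normK ?num_real // lerXn2r ?nnegrE ?(ltW a0).
  by have := sqr_ge0 (x j) => ? ?; rewrite ger0_norm; lra.
have s1 : `|pm (v j)| = 1 by rewrite /pm; case: ifP; rewrite ?normrN normr1.
rewrite normrM (normrM _ (pm _)) s1 mulr1 normrM.
rewrite [leRHS](_ : _ = a ^+ 2 * (`|pair_sign j k| * 2)); last by ring.
rewrite ler_pM // ler_wpM2l // gtr0_norm ?invr_gt0; last lra.
by rewrite invf_ple ?posrE; lra.
Qed.

(** The factor [tilt] cancels against [hard_dist], leaving pair signs that sum to zero. *)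
Lemma score_mean0 x v : in_cube a x -> \sum_k hard_dist x k * score x v k = 0.
Proof.
move=> hx; under eq_bigr do rewrite mulr_sumr.
rewrite exchange_big big1 //= => j _.
rewrite (eq_bigr (fun k => (a ^+ 2 - x j ^+ 2) * pm (v j) / d%:R * pair_sign j k)).
  by rewrite -mulr_sumr sum_pair_sign0 mulr0.
move=> k _; have t0 := tilt_ge k a2 hx.
by rewrite /hard_dist; field; rewrite !gt_eqF //; lra.
Qed.

(** Regroups the weighted divergence by user, so that [user_score_le] applies to each summand. *)
Lemma sum_weighted_dest x : \sum_j (a ^+ 2 - x j ^+ 2) * dest j x =
  \sum_(i < n) \sum_X data_prob (hard_dist x) X *
    \sum_v Q X v * \sum_(l < m) score x v (X i l).
Proof.
under eq_bigr do rewrite mulr_sumr.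
rewrite exchange_big [RHS]exchange_big /=; apply: eq_bigr => X _.
rewrite -mulr_sumr; under eq_bigr do rewrite -mulrA mulrCA.
rewrite -mulr_sumr; congr (_ * _).
rewrite [RHS]exchange_big /=; under [RHS]eq_bigr do rewrite -mulr_sumr.
under eq_bigr do rewrite /mean_sign 2!mulr_sumr.
rewrite exchange_big /=; apply: eq_bigr => v _.
rewrite (eq_bigr (fun j => Q X v * \sum_(i < n) \sum_(l < m)
   (a ^+ 2 - x j ^+ 2) * pm (v j) * (pair_sign j (X i l) / tilt x (X i l)))).
  rewrite -mulr_sumr exchange_big /=; congr (_ * _); apply: eq_bigr => i _.
  by rewrite exchange_big.
move=> j _; under [X in _ = _ * X]eq_bigr do rewrite -mulr_sumr.
by rewrite -mulr_sumr; ring.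
Qed.

(* The field [(a^2 - x_j^2) (est_j - 2 x_j / (3 a))] vanishes on the faces of
   the cube; subtracting the linear term makes the accuracy bound usable at the
   single point provided by [divergence_nonneg]. *)
Lemma fingerprint_bound : (0 < m)%N -> 0 < eps -> 0 <= delta ->
  2 * a / 3 * h%:R - 2 * err <=
  n%:R * (32 * eps * a ^+ 2 * Num.sqrt m%:R + 4 * delta * a ^+ 2 * m%:R).
Proof.
move=> m0 e0 del0; apply/ler_addgt0Pr => eta eta0.
(* With the coefficient [2 / (3 * a)], the linear term adds [2 / a * x j ^+ 2 - 2 / 3 * a] to the
   divergence: the first part is at most [2 * |x j|] and cancels against the accuracy bound, and the
   second sums to the main term. *)
pose W j x := (a ^+ 2 - x j * x j) * (est j x + (- (2 / (3 * a))) * x j).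
pose W' j x := - (2 * x j) * (est j x + (- (2 / (3 * a))) * x j) +
  (a ^+ 2 - x j * x j) * (dest j x - 2 / (3 * a)).
have hW j : has_partial a j (W j) (W' j).
  have ha := ltW a0; have hc := has_partial_coord j ha.
  apply: has_partial_ext (has_partialM ha
    (has_partialD (has_partial_cst a j (a ^+ 2))
      (has_partialZ ha (-1) (has_partialM ha hc hc)))
    (has_partialD (has_partial_est j) (has_partialZ ha (- (2 / (3 * a))) hc))).
    by move=> x _; rewrite /W mulN1r.
  by move=> x _; rewrite /W'; ring.
have W0 j x : in_cube a x -> `|x j| = a -> W j x = 0.
  by move=> _ xa; rewrite /W -xa -expr2 real_normK ?num_real // subrr mul0r.
have [x hx hdiv] := divergence_nonneg hW W0 a0 eta0.
have Ew : \sum_j W' j x = \sum_j (a ^+ 2 - x j ^+ 2) * dest j x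
    - 2 * \sum_j x j * est j x
    + \sum_j (2 / a * x j ^+ 2 - 2 / 3 * a).
  rewrite mulr_sumr -sumrB -big_split /=; apply: eq_bigr => j _.
  by rewrite /W'; field; rewrite gt_eqF.
have E1 : \sum_j x j * est j x = \sum_X data_prob (hard_dist x) X *
    \sum_v Q X v * \sum_j x j * pm (v j).
  under eq_bigr do rewrite mulr_sumr.
  rewrite exchange_big /=; apply: eq_bigr => X _.
  under eq_bigr do rewrite mulrCA; rewrite -mulr_sumr; congr (_ * _).
  under eq_bigr do rewrite mulr_sumr.
  rewrite exchange_big /=; apply: eq_bigr => v _; rewrite mulr_sumr.
  by apply: eq_bigr => j _; rewrite mulrCA.
have E2 : \sum_j (2 / a * x j ^+ 2 - 2 / 3 * a) <=
    2 * \sum_j `|x j| - 2 * a / 3 * h%:R.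
  rewrite (_ : 2 * a / 3 * h%:R = \sum_(j < h) 2 / 3 * a); last first.
    by rewrite sumr_const card_ord -mulr_natr; ring.
  rewrite mulr_sumr -sumrB; apply: ler_sum => j _; rewrite lerD2r.
  rewrite -mulrA ler_pM2l // mulrC ler_pdivrMr // -real_normK ?num_real //.
  by rewrite expr2 ler_wpM2l.
have E3 : \sum_j (a ^+ 2 - x j ^+ 2) * dest j x <=
    n%:R * (32 * eps * a ^+ 2 * Num.sqrt m%:R + 4 * delta * a ^+ 2 * m%:R).
  rewrite sum_weighted_dest.
  rewrite -[X in _ <= X%:R * _](card_ord n) mulr_natl -sumr_const.
  apply: ler_sum => i _.
  apply: le_trans (@user_score_le _ _ _ _ _ (hard_dist x) _ _ Q eps delta Q0 Q1
    Qdp (score x) (2 * a ^+ 2) i m0 e0 del0 _ _ _) _.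
  - by move=> k; exact: hard_dist_ge0 hx.
  - exact: sum_hard_dist.
  - by rewrite mulr_gt0 // exprn_gt0.
  - by move=> v k; exact: score_le.
  - by move=> v; exact: score_mean0.
  - lra.
have E4 := Qerr hx; rewrite E1 in Ew; lra.
Qed.

End Score.

End HardFamily.

(** * Push-forward of the output law to a finite set *)

Section Discretize.
Variables (R : realType) (disp : measure_display) (T : measurableType disp).
Variables (V : finType) (f : T -> V).
Hypothesis mf : forall v, measurable (f @^-1` [set v]).

Definition discretize (mu : probability T R) (v : V) : R :=
  fine (mu (f @^-1` [set v])).

Lemma discretize_ge0 mu v : 0 <= discretize mu v.
Proof. exact: fine_ge0. Qed.

Let indic_fiber (v : V) y : \1_(f @^-1` [set v]) y = (f y == v)%:R :> R.
Proof.
by rewrite indicE (_ : (y \in _) = (f y == v)) //; apply/idP/eqP; rewrite inE.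
Qed.

Let sum_fibers (rho : V -> R) y :
  (rho (f y))%:E = (\sum_v (rho v)%:E * (\1_(f @^-1` [set v]) y)%:E)%E.
Proof.
rewrite (bigD1 (f y)) //= indic_fiber eqxx mule1 big1 ?adde0 // => v vf.
by rewrite indic_fiber eq_sym (negPf vf) mule0.
Qed.

Lemma measurable_fiberwise (rho : V -> R) :
  measurable_fun setT (fun y => (rho (f y))%:E).
Proof.
rewrite (_ : (fun _ => _) = (fun y => \sum_v (rho v)%:E *
    (\1_(f @^-1` [set v]) y)%:E)%E); last by apply/funext => y; exact: sum_fibers.
apply: emeasurable_sum => v; apply: measurable_funeM; apply/measurable_EFinP.
exact: measurable_indic.
Qed.

Lemma integral_discretize (mu : probability T R) (rho : V -> R) :
  (forall v, 0 <= rho v) ->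
  (\int[mu]_y (rho (f y))%:E = (\sum_v discretize mu v * rho v)%:E)%E.
Proof.
move=> rho0; under eq_integral do rewrite sum_fibers.
rewrite ge0_integral_sum //; last 2 first.
- move=> v; apply: measurable_funeM; apply/measurable_EFinP.
  exact: measurable_indic.
- by move=> v y _; rewrite mule_ge0 ?lee_fin.
rewrite -sumEFin; apply: eq_bigr => v _.
rewrite ge0_integralZl_EFin //; last first.
  by apply/measurable_EFinP; exact: measurable_indic.
rewrite integral_indic // setIT EFinM muleC fineK //.
exact: fin_num_measure.
Qed.

Lemma sum_discretize mu : \sum_v discretize mu v = 1.
Proof.
apply: EFin_inj; under eq_bigr do rewrite -[discretize mu _]mulr1.
rewrite -(@integral_discretize mu (fun=> 1)) //.
by rewrite (@integral_cst _ _ _ mu _ measurableT 1%:E) mul1e; apply: probability_setT.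
Qed.

Let measurable_fiber_set (A : {set V}) : measurable (f @^-1` [set` A]).
Proof.
rewrite (_ : f @^-1` _ = \bigcup_(v in [set` A]) (f @^-1` [set v])).
  by apply: fin_bigcup_measurable => //; exact: finite_finpred.
apply/seteqP; split=> y /= => [fA|[v /= vA ->] //].
by exists (f y).
Qed.

Lemma discretize_set (mu : probability T R) (A : {set V}) :
  mu (f @^-1` [set` A]) = (\sum_(v in A) discretize mu v)%:E.
Proof.
have mA := measurable_fiber_set A.
rewrite big_mkcond /=.
rewrite (eq_bigr (fun v => discretize mu v * (v \in A)%:R)); last first.
  by move=> v _; case: ifP; rewrite ?mulr1 ?mulr0.
rewrite -(@integral_discretize mu (fun v => (v \in A)%:R)) //.
rewrite -[in LHS](setIT (f @^-1` _)) -integral_indic //.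
apply: eq_integral => y _; rewrite indicE.
by rewrite (_ : (y \in _) = (f y \in A)) //; apply/idP/idP; rewrite inE.
Qed.

(** Post-processing: an event on the finite side is a measurable event on the outputs. *)
Lemma discretize_dp (mu nu : probability T R) (eps delta : R) :
  (forall S, measurable S -> (mu S <= (expR eps)%:E * nu S + delta%:E)%E) ->
  dp_events (discretize mu) (discretize nu) eps delta.
Proof.
move=> H A; have := H _ (measurable_fiber_set A).
by rewrite !discretize_set -EFinM -EFinD lee_fin.
Qed.

End Discretize.

(** * From the accuracy hypothesis to the sample bound *)

Section LowerBound.
Variable R : realType.

Definition out_pattern (d : nat) (y : vec R d) : {ffun 'I_d./2 -> bool} :=
  pattern (tnth y).

Lemma measurable_out_pattern d (v : {ffun 'I_d./2 -> bool}) :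
  measurable (@out_pattern d @^-1` [set v]).
Proof.
pose s j (y : vec R d) := \sum_k pair_sign R j k * tnth y k.
have ms j : measurable_fun setT (s j).
  apply: measurable_sum => k; apply: measurable_funM; first exact: measurable_cst.
  exact: measurable_tnth.
(* A fibre is a finite intersection of sets [s j y >= 0] and complements of such sets. *)
rewrite (_ : _ @^-1` _ = \bigcap_(j in setT) [set y | (0 <= s j y) = v j]).
  apply: fin_bigcap_measurable => [|j _]; first exact: finite_finset.
  have mj : measurable (s j @^-1` [set` `[0, +oo[]).
    by rewrite -[X in measurable X]setTI; exact: ms.
  case: (v j).
    rewrite (_ : [set _ | _] = s j @^-1` [set` `[0, +oo[]) //.
    by apply/seteqP; split=> y /=; rewrite in_itv /= andbT.
  rewrite (_ : [set _ | _] = ~` (s j @^-1` [set` `[0, +oo[])).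
    exact: measurableC.
  apply/seteqP; split=> y /=; rewrite in_itv /= andbT; first by move=> ->.
  by move/negP/negbTE.
apply/seteqP; split=> y /=.
  by move=> <- j _ /=; rewrite /out_pattern ffunE.
by move=> H; apply/ffunP => j; rewrite /out_pattern ffunE; exact: H.
Qed.

Lemma measurable_l1dist d (p : vec R d) :
  measurable_fun setT (fun y : vec R d => l1dist y p).
Proof.
apply: measurable_sum => k; apply: measurableT_comp => //.
apply: measurable_funB; last exact: measurable_cst.
exact: measurable_tnth.
Qed.

Definition hard_vec d (x : 'I_d./2 -> R) : vec R d := [tuple hard_dist x k | k < d].

Lemma tnth_hard_vec d (x : 'I_d./2 -> R) k : tnth (hard_vec x) k = hard_dist x k.
Proof. by rewrite tnth_mktuple. Qed.

(** Integrates [pattern_accurate], trading the distance [l] for its square by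
    [l <= c * l ^+ 2 + 1 / (4 * c)]; [c] stays free for tuning. *)
Lemma pattern_error d (mu : probability (vec R d) R) (x : 'I_d./2 -> R)
    (c : R) : (2 <= d)%N -> 0 < c ->
  ((\sum_v discretize (@out_pattern d) mu v *
      (\sum_j `|x j| - \sum_j x j * pm R (v j)))%:E <=
   (d%:R * c)%:E * \int[mu]_y (l1dist y (hard_vec x) ^+ 2)%:E
     + (d%:R / (4 * c))%:E)%E.
Proof.
move=> d2 c0.
have dc0 : 0 <= d%:R * c by rewrite mulr_ge0 // ltW.
have dc1 : 0 <= d%:R / (4 * c) by rewrite divr_ge0 // mulr_ge0 // ltW.
rewrite -(@integral_discretize _ _ _ _ _ (@measurable_out_pattern d) mu
  (fun v => \sum_j `|x j| - \sum_j x j * pm R (v j))); last first.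
  move=> v; rewrite -sumrB; apply: sumr_ge0 => j _.
  rewrite subr_ge0; apply: le_trans (ler_norm _) _.
  by rewrite normrM /pm; case: ifP => _; rewrite ?normrN normr1 mulr1.
have ml : measurable_fun setT (fun y : vec R d =>
    (l1dist y (hard_vec x) ^+ 2)%:E).
  by apply/measurable_EFinP; apply: measurable_funX; exact: measurable_l1dist.
rewrite -ge0_integralZl_EFin //; last by move=> y _; rewrite lee_fin sqr_ge0.
rewrite -[X in (_ + X)%E]mule1 -(probability_setT mu) -(integral_cst mu measurableT).
rewrite -ge0_integralD //; last 2 first.
- by move=> y _; rewrite mule_ge0 // lee_fin // sqr_ge0.
- exact: measurable_funeM.
apply: ge0_le_integral => //.
- move=> y _; rewrite lee_fin subr_ge0; apply: ler_sum => j _.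
  apply: le_trans (ler_norm _) _.
  by rewrite normrM /pm; case: ifP => _; rewrite ?normrN normr1 mulr1.
- exact: (measurable_fiberwise (@measurable_out_pattern d)
    (fun v => \sum_j `|x j| - \sum_j x j * pm R (v j))).
- by apply: emeasurable_funD => //; exact: measurable_funeM.
move=> y _; rewrite -EFinM -EFinD lee_fin.
have := pattern_accurate d2 x (tnth y).
have <- : l1dist y (hard_vec x) = \sum_k `|tnth y k - hard_dist x k|.
  by apply: eq_bigr => k _; rewrite tnth_hard_vec.
set l := l1dist _ _; rewrite -/(out_pattern y) => acc.
have amgm : d%:R * l <= d%:R * c * l ^+ 2 + d%:R / (4 * c).
  rewrite -subr_ge0 [leRHS](_ : _ = d%:R * (c * (l - (2 * c)^-1) ^+ 2)); last first.
    by field; rewrite gt_eqF.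
  by rewrite mulr_ge0 // mulr_ge0 ?sqr_ge0 // ltW.
lra.
Qed.

(** The non-asymptotic bound, by contradiction: too few samples would make the privacy side of
    [fingerprint_bound] smaller than its accuracy side. *)
Lemma sample_lower_bound (n m d : nat) (eps alpha delta : R)
    (M : algorithm R n m d) :
  (0 < n)%N -> (0 < m)%N -> (2 <= d)%N -> 0 < eps -> 0 < alpha <= 1 ->
  user_level_dp M eps delta ->
  delta <= 4 * (eps * alpha) / (d%:R ^+ 2 * Num.sqrt m%:R) ->
  (forall p : vec R d, is_distribution p ->
     (expected_sq_error M p <= (alpha ^+ 2 / 1000)%:E)%E) ->
  d%:R / (300 * (eps * alpha)) <= n%:R * Num.sqrt m%:R.
Proof.
move=> n0 m0 d2 e0 /andP[al0 al1] dp dle acc.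
have dR : 2 <= d%:R :> R by rewrite ler_nat.
have mR : 1 <= m%:R :> R by rewrite ler1n.
set s : R := Num.sqrt m%:R in dle *.
have s1 : 1 <= s by rewrite -sqrtr1 ler_sqrt // ltW.
have sE : s ^+ 2 = m%:R by rewrite sqr_sqrtr // ltW.
have ea0 : 0 < eps * alpha by rewrite mulr_gt0.
have nR : 0 <= n%:R :> R by [].
(* Privacy of a dataset against itself, tested on the empty event. *)
have del0 : 0 <= delta.
  pose X0 : dataset n m d := const_mx (Ordinal (ltnW d2)).
  have nb : neighboring X0 X0 by exists (Ordinal n0).
  by have := dp _ _ nb set0 measurable0; rewrite !measure0 mule0 add0e lee_fin.
pose a := alpha / 2.
have a0 : 0 < a by rewrite /a; lra.
have a2 : a <= 1 / 2 by rewrite /a; lra.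
pose Q (X : 'M['I_d]_(n, m)) := discretize (@out_pattern d) (M X).
have Q0 X v : 0 <= Q X v by exact: discretize_ge0.
have Q1 X : \sum_v Q X v = 1.
  exact: sum_discretize (@measurable_out_pattern d) (M X).
have Qdp X i r : dp_events (Q X) (Q (set_row X i r)) eps delta /\
    dp_events (Q (set_row X i r)) (Q X) eps delta.
  split; apply: (discretize_dp (@measurable_out_pattern d)) => S mS; apply: dp => //;
    by exists i => i' /negPf ii j; rewrite mxE ii.
(* Nearly balances the two terms of [err], which become [16 / 1000] and [1 / 64] times
   [d%:R * alpha]. *)
pose c : R := 16 / alpha.
have c0 : 0 < c by rewrite divr_gt0.
pose err := d%:R * c * (alpha ^+ 2 / 1000) + d%:R / (4 * c).
have Qerr x : in_cube a x -> \sum_j `|x j| - err <=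
    \sum_X data_prob (hard_dist x) X * \sum_v Q X v * \sum_j x j * pm R (v j).
  move=> hx; have p0 k : 0 <= hard_dist x k by exact: hard_dist_ge0 hx.
  have p1 := sum_hard_dist d2 x.
  have isd : is_distribution (hard_vec x).
    by split=> [k|]; [|rewrite -p1; apply: eq_bigr => k _]; rewrite tnth_hard_vec.
  have iidE X : iid_prob (hard_vec x) X = data_prob (hard_dist x) X.
    by apply: eq_bigr => i _; apply: eq_bigr => j _; rewrite tnth_hard_vec.
  have dc0 : 0 <= d%:R * c by rewrite mulr_ge0 // ltW.
  have : ((\sum_X data_prob (hard_dist x) X * \sum_v Q X v *
      (\sum_j `|x j| - \sum_j x j * pm R (v j)))%:E <= err%:E)%E.
    rewrite -sumEFin.
    apply: (@le_trans _ _ (\sum_X (data_prob (hard_dist x) X)%:E *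
       ((d%:R * c)%:E * \int[M X]_y (l1dist y (hard_vec x) ^+ 2)%:E
        + (d%:R / (4 * c))%:E))%E).
      apply: lee_sum => X _; rewrite EFinM.
      by apply: lee_wpmul2l; [rewrite lee_fin data_prob_ge0|exact: pattern_error].
    have I0 X : (0 <= \int[M X]_y (l1dist y (hard_vec x) ^+ 2)%:E)%E.
      by apply: integral_ge0 => y _; rewrite lee_fin sqr_ge0.
    have t0 : 0 <= d%:R / (4 * c) by rewrite divr_ge0 // mulr_ge0 // ltW.
    under eq_bigr => X _.
      rewrite ge0_muleDr; [|by rewrite mule_ge0 ?lee_fin ?I0|by rewrite lee_fin].
      rewrite muleCA; over.
    rewrite big_split /= -ge0_sume_distrr; last first.
      by move=> X _; rewrite mule_ge0 // lee_fin data_prob_ge0.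
    rewrite /err EFinD (EFinM (d%:R * c) (alpha ^+ 2 / 1000)); apply: leeD.
      apply: lee_wpmul2l; first by rewrite lee_fin.
      apply: le_trans (acc _ isd); rewrite /expected_sq_error.
      by apply: lee_sum => X _; rewrite iidE.
    under eq_bigr do rewrite -EFinM.
    by rewrite sumEFin -mulr_suml sum_data_prob // mul1r.
  rewrite lee_fin.
  under eq_bigr do under eq_bigr do rewrite mulrBr.
  under eq_bigr do rewrite sumrB -mulr_suml Q1 mul1r mulrBr.
  by rewrite sumrB -mulr_suml sum_data_prob // mul1r; lra.
have fb := fingerprint_bound d2 a0 a2 Q0 Q1 Qdp Qerr m0 e0 del0.
have hd := half_dim_ge R d2.
rewrite leNgt; apply/negP => small.
rewrite ltr_pdivlMr in small; last by rewrite mulr_gt0.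
have errE : err = (16 / 1000 + 1 / 64) * (d%:R * alpha).
  by rewrite /err /c; field; rewrite gt_eqF.
have ad0 : 0 <= alpha * d%:R by rewrite mulr_ge0 // ltW.
(* In units of [alpha * d%:R], accuracy forces at least [2 / 45], while privacy allows at most
   [2 / 75 + 1 / 300 = 3 / 100]. *)
have L1 : alpha * d%:R * (2 / 45) <= 2 * a / 3 * (d./2)%:R - 2 * err.
  by have := ler_wpM2l (ltW al0) hd; rewrite errE /a; lra.
have L2 : n%:R * (32 * eps * a ^+ 2 * s) <= alpha * d%:R * (2 / 75).
  have := ler_wpM2l (ltW al0) (ltW small); rewrite /a; lra.
have L3 : n%:R * (4 * delta * a ^+ 2 * m%:R) <= alpha * d%:R / 300.
  have ds : delta * s <= 4 * (eps * alpha) / d%:R ^+ 2.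
    have s0 : 0 <= s by lra.
    have := ler_wpM2r s0 dle.
    rewrite [leRHS](_ : _ = 4 * (eps * alpha) / d%:R ^+ 2) //.
    by field; rewrite !gt_eqF //; lra.
  have ns0 : 0 <= n%:R * s by rewrite mulr_ge0 //; lra.
  have e1 : n%:R * (4 * delta * a ^+ 2 * m%:R) = alpha ^+ 2 * (n%:R * s * (delta * s)).
    by rewrite -sE /a; field.
  have e2 := ler_wpM2l (sqr_ge0 alpha) (ler_wpM2l ns0 ds).
  rewrite e1; apply: le_trans e2 _.
  have e3 : n%:R * s * (eps * alpha) <= d%:R / 300 by lra.
  have dd : 4 <= d%:R ^+ 2 :> R by rewrite expr2; nra.
  have e4 := ler_wpM2l (sqr_ge0 alpha) e3.
  rewrite [leLHS](_ : _ = alpha ^+ 2 * (n%:R * s * (eps * alpha)) * (4 / d%:R ^+ 2)); last by field; rewrite gt_eqF //; lra.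
  have q0 : 0 <= 4 / d%:R ^+ 2 :> R by rewrite divr_ge0 // sqr_ge0.
  have q1 : 4 / d%:R ^+ 2 <= 1 :> R by rewrite ler_pdivrMr ?mul1r //; lra.
  apply: le_trans (ler_pM _ q0 e4 q1) _.
    by rewrite mulr_ge0 ?sqr_ge0 // mulr_ge0 // ltW.
  rewrite mulr1 expr2 mulrA; have := ler_wpM2r ad0 al1; lra.
have : 0 < alpha * d%:R by rewrite mulr_gt0 //; lra.
by rewrite -/s [leRHS]mulrDr in fb; lra.
Qed.

End LowerBound.

(* The parameters and the algorithm range over an arbitrary family indexed by
   [T]; [o] is taken along an arbitrary filter [F] on [T], and the constant
   [C] hidden in the [Omega] is absolute: it is chosen before the family. *)
Theorem theorem9 (R : realType) :
  exists C : R, 0 < C /\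
  forall (T : Type) (F : filter_on T)
    (n m d : T -> nat) (eps alpha delta : T -> R)
    (M : forall t : T, algorithm R (n t) (m t) (d t)),
  (forall t, (0 < n t)%N /\ (0 < m t)%N /\ (2 <= d t)%N) ->
  (forall t, 0 < eps t) ->
  (forall t, 0 < alpha t <= 1) ->
  (forall t, 2 <= (d t)%:R / (eps t * alpha t)) ->
  (forall t, user_level_dp (M t) (eps t) (delta t)) ->
  (delta : T -> R^o) =o_F
    (fun t => eps t * alpha t /
       ((d t)%:R ^+ 2 * Num.sqrt (m t)%:R *
        ln ((d t)%:R / (eps t * alpha t)) ^+ 2) : R^o) ->
  (forall t (p : vec R (d t)), is_distribution p ->
     (expected_sq_error (M t) p <= (alpha t ^+ 2 / 1000)%:E)%E) ->
  \forall t \near F,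
    C * ((eps t)^-1 * (alpha t)^-1 * (d t)%:R /
         ln ((d t)%:R / (alpha t * eps t)) ^+ 6)
    <= (n t)%:R * Num.sqrt (m t)%:R.

Proof.
(* [19200 = 300 * 64]: the logarithm is at least [1 / 2], so its inverse sixth power is at most 64,
   and 300 is the constant of [sample_lower_bound]. *)
exists (1 / 19200); split=> [|T F n m d eps alpha delta M pos e0 al0 ge2 dp dlo acc].
  lra.
(* The little-o is instantiated with constant 1; the inverse square of the logarithm is at most 4,
   the factor in the condition on [delta] of [sample_lower_bound]. *)
move/eqoP: dlo => /(_ 1 ltr01); apply: filterS => t /= dlt.
have [n0 [m0 d2]] := pos t.
have ea0 : 0 < eps t * alpha t by rewrite mulr_gt0 //; case/andP: (al0 t).
have dR : 2 <= (d t)%:R :> R by rewrite ler_nat.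
have s0 : 0 < Num.sqrt (m t)%:R :> R by rewrite sqrtr_gt0 ltr0n.
rewrite [alpha t * eps t]mulrC; set L := ln _ in dlt *.
have L2 : 1 / 2 <= L.
  rewrite -[1 / 2]expRK ler_ln ?posrE ?expR_gt0 //; last by have := ge2 t; lra.
  exact: le_trans (expR_half_le2 R) (ge2 t).
have key := @sample_lower_bound R (n t) (m t) (d t) (eps t) (alpha t) (delta t)
  (M t) n0 m0 d2 (e0 t) (al0 t) (dp t) _ (acc t).
have A0 : 0 <= (d t)%:R / (eps t * alpha t).
  by apply: divr_ge0 (ler0n _ _) (ltW ea0).
have L0 : 0 < L by lra.
have iL0 : 0 <= L^-1 by rewrite invr_ge0 ltW.
have iL2 : L^-1 <= 2 by rewrite invf_ple ?posrE //; lra.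
apply: le_trans (key _).
  have i6 : L^-1 ^+ 6 <= 64.
    apply: le_trans (lerXn2r 6 _ _ iL2) _; rewrite ?nnegrE //; lra.
  have [h1 h2] : eps t != 0 /\ alpha t != 0.
    by split; rewrite gt_eqF //; case/andP: (al0 t).
  rewrite [leLHS](_ : _ = (d t)%:R / (eps t * alpha t) * L^-1 ^+ 6 / 19200);
    last by field; rewrite ?h1 ?h2 ?gt_eqF.
  have := ler_wpM2l A0 i6.
  by rewrite [(300 * _)^-1]invfM; lra.
apply: le_trans (ler_norm _) (le_trans dlt _); rewrite mul1r.
set w := _ ^+ 2 * Num.sqrt _.
have w0 : 0 < w by rewrite mulr_gt0 ?exprn_gt0 //; lra.
have q0 : 0 <= eps t * alpha t / w by rewrite divr_ge0 // ltW.
have i2 : L^-1 ^+ 2 <= 4.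
  apply: le_trans (lerXn2r 2 _ _ iL2) _; rewrite ?nnegrE //; lra.
rewrite [in leLHS]invfM [in leLHS]mulrA -exprVn ger0_norm.
  by have := ler_wpM2l q0 i2; lra.
by rewrite mulr_ge0 ?sqr_ge0.
Qed.
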